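(* Let $(x,a,p,s)\in\mathbb{F}$. Then $(s,ax-p)\in\mathbb{G}_2$, $(x,a,p)\in\mathbb{E}$ and $(a,s,-p)\in\mathbb{P}$.
   Context: $M_2(\mathbb{C})$ is the space of $2\times 2$ complex matrices and $\|A\|$ is the operator norm of $A$. The domain $\mathbb{F}$ is \[ \mathbb{F}=\{(a_{11},a_{22},\det(A),a_{12}+a_{21})\in\mathbb{C}^4 : A=(a_{ij})_{i,j=1}^2\in M_2(\mathbb{C}),\ \|A\|<1\}. \] The symmetrized bidisc is $\mathbb{G}_2=\{(z_1+z_2,z_1z_2)\in\mathbb{C}^2 : |z_1|<1,\ |z_2|<1\}$. The tetrablock is $\mathbb{E}=\{(x_1,x_2,x_3)\in\mathbb{C}^3 : 1-x_1z_1-x_2z_2+x_3z_1z_2\neq 0 \text{ for all } |z_1|\le 1,\ |z_2|\le 1\}$. The pentablock is $\mathbb{P}=\{(a_{21},\mathrm{tr}(A),\det(A))\in\mathbb{C}^3 : A=(a_{ij})_{i,j=1}^2\in M_2(\mathbb{C}),\ \|A\|<1\}$. *)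

(* Defs.v *)
From mathcomp Require Import all_boot all_order all_algebra.
From mathcomp Require Import classical_sets reals.
From mathcomp Require Import complex.

Set Implicit Arguments.
Unset Strict Implicit.
Unset Printing Implicit Defensive.

Import Order.TTheory GRing.Theory Num.Theory.
Import ComplexField.Normc.

Local Open Scope classical_set_scope.
Local Open Scope ring_scope.

(* [normc] is the modulus valued in [R]; the generic norm [`|z|] on [R[i]] is
   the same number seen in [R[i]]. *)
Definition l2norm (R : realType) (n : nat) (v : 'cV[R[i]]_n) : R :=
  Num.sqrt (\sum_(i < n) normc (v i 0) ^+ 2).

(* The set below is nonempty and bounded, so [sup] is a genuine supremum. *)
Definition opnorm (R : realType) (n : nat) (A : 'M[R[i]]_n) : R :=
  sup [set l2norm (A *m v) | v in [set v : 'cV[R[i]]_n | l2norm v <= 1]].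

(* Matrix indices are shifted: the informal a_{ij} is [A (i - 1) (j - 1)]. *)
Definition domainF (R : realType) : set (R[i] * R[i] * R[i] * R[i]) :=
  [set (A 0 0, A 1 1, \det A, A 0 1 + A 1 0) |
    A in [set A : 'M[R[i]]_2 | opnorm A < 1]].

Definition symm_bidisc (R : realType) : set (R[i] * R[i]) :=
  [set (z1 + z2, z1 * z2) |
    z1 in [set z : R[i] | `|z| < 1] & z2 in [set z : R[i] | `|z| < 1]].

Definition tetrablock (R : realType) : set (R[i] * R[i] * R[i]) :=
  [set x | forall z1 z2 : R[i], `|z1| <= 1 -> `|z2| <= 1 ->
     1 - x.1.1 * z1 - x.1.2 * z2 + x.2 * z1 * z2 != 0].

Definition pentablock (R : realType) : set (R[i] * R[i] * R[i]) :=
  [set (A 1 0, \tr A, \det A) | A in [set A : 'M[R[i]]_2 | opnorm A < 1]].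

(* Main.v *)
(* Let [A = [[x, b], [c, a]]] have norm less than 1.  The entries [b], [c] lie
   in the unit disc, and [b + c = s], [b c = a x - p].  With
   [D = diag(z1, z2)] a contraction, [1 - x z1 - a z2 + p z1 z2] is
   [det(1 - A D)], which is nonzero because [|A D| < 1].  Swapping the columns
   of [A] preserves the norm and gives [[b, x], [a, c]], a matrix with
   (2,1)-entry [a], trace [s] and determinant [-p]. *)
Require Import Defs.
From mathcomp Require Import all_boot all_order all_algebra.
From mathcomp Require Import classical_sets reals.
From mathcomp Require Import complex perm ring.

Import Order.TTheory GRing.Theory Num.Theory.
Import ComplexField.Normc.

Local Open Scope ring_scope.

Section OperatorNorm.
Variable R : realType.
Implicit Types (z c : R[i]).

Lemma normr_normc z : `|z| = (normc z)%:C%C.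
Proof. by case: z. Qed.

Lemma normc_ge0 z : 0 <= normc z.
Proof. by case: z => a b; rewrite sqrtr_ge0. Qed.

Variable n : nat.
Implicit Types (A : 'M[R[i]]_n) (v w : 'cV[R[i]]_n).

Lemma sqr_l2norm v : l2norm v ^+ 2 = \sum_(i < n) normc (v i 0) ^+ 2.
Proof. by rewrite sqr_sqrtr// sumr_ge0// => i _; rewrite sqr_ge0. Qed.

Lemma l2norm_le v w :
  (forall i, normc (v i 0) <= normc (w i 0)) -> l2norm v <= l2norm w.
Proof.
move=> vw; rewrite /l2norm ler_wsqrtr//; apply: ler_sum => i _.
by rewrite lerXn2r// nnegrE normc_ge0.
Qed.

Lemma normc_coord_le v i : normc (v i 0) <= l2norm v.
Proof.
rewrite -(@ler_pXn2r _ 2)// ?nnegrE ?normc_ge0 ?sqrtr_ge0//.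
rewrite sqr_l2norm (bigD1 i)//= lerDl.
by apply: sumr_ge0 => j _; rewrite sqr_ge0.
Qed.

Lemma l2normZ c v : l2norm (c *: v) = normc c * l2norm v.
Proof.
rewrite -[normc c]ger0_norm ?normc_ge0// -sqrtr_sqr -sqrtrM ?sqr_ge0//.
rewrite /l2norm mulr_sumr; congr Num.sqrt; apply: eq_bigr => i _.
by rewrite mxE normcM exprMn.
Qed.

Lemma l2norm_gt0 v : v != 0 -> 0 < l2norm v.
Proof.
move=> v0; rewrite lt_neqAle sqrtr_ge0 andbT eq_sym; apply: contra v0 => /eqP v0.
apply/eqP/colP => i; rewrite mxE; apply: eq0_normc; apply/eqP.
by rewrite eq_le normc_ge0 -{1}v0 normc_coord_le.
Qed.

Lemma normc_sum_le (I : finType) (f : I -> R[i]) :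
  normc (\sum_i f i) <= \sum_i normc (f i).
Proof.
elim/big_ind2: _ => [|x y z t xy zt|//]; first by rewrite normc0.
by rewrite (le_trans (le_normcD _ _))// lerD.
Qed.

Lemma l2norm_le_opnorm A v : l2norm v <= 1 -> l2norm (A *m v) <= opnorm A.
Proof.
move=> v1; apply: ub_le_sup; last by exists v.
(* This upper bound makes the supremum genuine: on the unit ball every coordinate has modulus at
   most 1, so coordinate [i] of [A *m w] is bounded by the absolute sum of row [i]. *)
exists (Num.sqrt (\sum_i (\sum_j normc (A i j)) ^+ 2)) => _ [w /= w1 <-].
rewrite ler_wsqrtr//; apply: ler_sum => i _.
rewrite lerXn2r ?nnegrE ?normc_ge0 ?sumr_ge0// => [j _|]; first exact: normc_ge0.
rewrite mxE (le_trans (normc_sum_le _ _))//; apply: ler_sum => j _.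
by rewrite normcM ler_piMr ?normc_ge0// (le_trans (normc_coord_le _ _)).
Qed.

Lemma l2norm0 : l2norm (0 : 'cV[R[i]]_n) = 0.
Proof. by rewrite -(scale0r (0 : 'cV[R[i]]_n)) l2normZ normc0 mul0r. Qed.

Lemma opnorm_le A (C : R) :
  (forall v, l2norm v <= 1 -> l2norm (A *m v) <= C) -> opnorm A <= C.
Proof.
move=> A_le; apply: ge_sup => [|_ [v /= v1 <-]]; last exact: A_le.
(* The zero vector shows that the set of values is nonempty, as [ge_sup] requires. *)
by exists (l2norm (A *m 0)), 0; rewrite //= l2norm0.
Qed.

(** [B] maps the unit ball into itself, so [A *m B] takes there only values that [A] takes on the
    ball. *)
Lemma opnorm_mulmx_contraction A (B : 'M[R[i]]_n) :
  (forall v, l2norm (B *m v) <= l2norm v) -> opnorm (A *m B) <= opnorm A.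
Proof.
move=> B1; apply: opnorm_le => v v1.
by rewrite -mulmxA l2norm_le_opnorm// (le_trans (B1 v)).
Qed.

(** The entry is coordinate [i] of the image of the unit vector [delta_mx j 0]. *)
Lemma normc_entry_le_opnorm A i j : normc (A i j) <= opnorm A.
Proof.
have e1 : l2norm (delta_mx j 0 : 'cV[R[i]]_n) <= 1.
  rewrite /l2norm (bigD1 j)//= big1 => [|k kj].
    by rewrite mxE !eqxx normc1 expr1n addr0 sqrtr1.
  by rewrite mxE (negbTE kj) normc0 expr0n.
have := le_trans (normc_coord_le _ i) (l2norm_le_opnorm A _ e1).
by rewrite -colE mxE.
Qed.

(** A null vector of [1%:M - A] is fixed by [A]; scaled to norm 1, it would force [opnorm A] to be
    at least 1. *)
Lemma det_1B_neq0 A : opnorm A < 1 -> \det (1%:M - A) != 0.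
Proof.
(* [det0P] produces a row vector killed from the left; transposing first turns it into a column that
   [1%:M - A] kills. *)
move=> A1; rewrite -det_tr; apply/negP => /det0P[u u0 uA].
pose v := u^T; have v0 : 0 < l2norm v by apply: l2norm_gt0; rewrite trmx_eq0.
have vA : A *m v = v.
  have /eqP : (1%:M - A) *m v = 0 by rewrite -[LHS]trmxK trmx_mul trmxK uA trmx0.
  by rewrite mulmxBl mul1mx subr_eq0 => /eqP <-.
have nc : normc ((l2norm v)^-1)%:C%C = (l2norm v)^-1.
  by rewrite /= expr0n addr0 sqrtr_sqr ger0_norm// invr_ge0 ltW.
pose w := ((l2norm v)^-1)%:C%C *: v.
have w1 : l2norm w = 1 by rewrite l2normZ nc mulVf ?gt_eqF.
have := l2norm_le_opnorm A w; rewrite w1 -scalemxAr vA -/w w1 => /(_ (lexx _)).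
by rewrite leNgt A1.
Qed.

End OperatorNorm.

Lemma l2norm_xrow (R : realType) n (i j : 'I_n) (v : 'cV[R[i]]_n) :
  l2norm (xrow i j v) = l2norm v.
Proof.
rewrite /l2norm [in RHS](reindex_inj (@perm_inj _ (tperm i j))) /=.
by congr Num.sqrt; apply: eq_bigr => k _; rewrite mxE.
Qed.

Lemma sum_ord2 (V : nmodType) (f : 'I_2 -> V) : \sum_i f i = f 0 + f 1.
Proof. by rewrite big_ord_recl big_ord1; congr (_ + f _); apply: val_inj. Qed.

Lemma det_mx22 (S : comNzRingType) (M : 'M[S]_2) :
  \det M = M 0 0 * M 1 1 - M 0 1 * M 1 0.
Proof.
rewrite (expand_det_row _ 0) sum_ord2 /cofactor !det_mx11 !mxE /=.
have -> : lift 0 0 = 1 :> 'I_2 by apply: val_inj.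
have -> : lift 1 0 = 0 :> 'I_2 by apply: val_inj.
by rewrite expr0 expr1 mul1r mulN1r mulrN.
Qed.

Theorem theorem2p12 (R : realType) (x a p s : R[i]) :
  domainF (x, a, p, s) ->
  [/\ symm_bidisc (s, a * x - p),
      tetrablock (x, a, p)
    & pentablock (a, s, - p)].
Proof.
case=> A /= A1 [<- <- <- <-].
have A_lt1 i j : `|A i j| < 1.
  by rewrite normr_normc ltcR (le_lt_trans (normc_entry_le_opnorm _ _ _ _ _)).
split.
- exists (A 0 1); first exact: A_lt1.
  exists (A 1 0); first exact: A_lt1.
  congr pair.
  by rewrite det_mx22; ring.
- move=> z1 z2 z1_le1 z2_le1 /=.
  pose D : 'M[R[i]]_2 := diag_mx (\row_j if j == 0 then z1 else z2).
  have D1 v : l2norm (D *m v) <= l2norm v.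
    apply: l2norm_le => i; rewrite mul_diag_mx !mxE normcM ler_piMl ?normc_ge0//.
    (* The bounds on [z1] and [z2] are inequalities in [R[i]], so the real inequality is moved there
       before splitting on the index. *)
    by rewrite -lecR -normr_normc; case: ifP.
  have := det_1B_neq0 _ _ _ (le_lt_trans (opnorm_mulmx_contraction _ _ A D D1) A1).
  congr (_ != 0); rewrite mul_mx_diag !det_mx22 !mxE /=; ring.
- exists (xcol 0 1 A) => /=.
    (* The column swap is right multiplication by a permutation matrix, which acts on vectors by
       exchanging coordinates and so preserves [l2norm]. *)
    rewrite xcolE; apply: le_lt_trans A1; apply: opnorm_mulmx_contraction => v.
    by rewrite -xrowE l2norm_xrow.
  rewrite /mxtrace sum_ord2 !det_mx22 !mxE tpermL tpermR.
  by congr (_, _, _); ring.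
Qed.
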